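(* Let $n$ be a positive integer and suppose that $f\in\mathcal{W}_{n}$. Then for every $m\in\{1,\ldots,n\}$ there exists a polynomial $g\in\mathcal{H}_{m}$ having a Hadamard factorization and such that $f\bullet g\subset\mathcal{H}_{m}$.
   Context: For an integer $k\ge 0$, $\mathbb{R}_k^+$ denotes the set of real polynomials $s\mapsto c_0+c_1s+\ldots+c_ks^k$ with all $c_i>0$ ($i=0,\ldots,k$). For $k\ge 1$, $\mathcal{H}_k$ is the set of $f\in\mathbb{R}_k^+$ all of whose complex zeros have negative real part (Hurwitz stable polynomials). For $k\ge 3$ and $f(s)=a_0+a_1s+\ldots+a_ks^k\in\mathbb{R}_k^+$ put $\lambda_i(f)=\dfrac{a_{i-2}a_{i+1}}{a_ia_{i-1}}$ for $i=2,\ldots,k-1$, and let $\mathcal{W}_k=\{f\in\mathbb{R}_k^+:\lambda_i(f)<1\ (i=2,\ldots,k-1)\}$. By definition $\mathcal{W}_k=\mathcal{H}_k$ for $k=1,2$. Here $\circ$ denotes the Hadamard (coefficientwise) product, not composition: for $p(s)=\sum_{i=0}^m p_is^i$ and $q(s)=\sum_{i=0}^m q_is^i$ in $\mathbb{R}_m^+$, $(p\circ q)(s)=\sum_{i=0}^m p_iq_is^i$. A polynomial $g\in\mathcal{H}_m$ has a Hadamard factorization if there exist $g_1,g_2\in\mathcal{H}_m$ with $g=g_1\circ g_2$. For $f(s)=\sum_{i=0}^n a_is^i\in\mathbb{R}_n^+$ and $g(s)=\sum_{i=0}^m b_is^i\in\mathbb{R}_m^+$ with $m\le n$, the generalized Hadamard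 product of $f$ and $g$ is the set $f\bullet g=\{F_0,\ldots,F_{n-m}\}$, where $F_j(s)=\sum_{i=0}^m a_{j+i}b_is^i$ for $j=0,\ldots,n-m$. *)

(* Defs.v *)
From HB Require Import structures.
From mathcomp Require Import all_boot all_order all_algebra.
From mathcomp Require Import classical_sets reals.
From mathcomp Require Import complex.

Set Implicit Arguments.
Unset Strict Implicit.
Unset Printing Implicit Defensive.

Import Order.TTheory GRing.Theory Num.Theory.
Local Open Scope classical_set_scope.
Local Open Scope ring_scope.

Section Defs.
Variable R : realType.
Implicit Types (k m n : nat) (f g p q : {poly R}).

(* The set R_k^+; the size of a polynomial is its degree + 1. *)
Definition pos_polys k : set {poly R} :=
  [set f | size f = k.+1 /\ forall i, (i <= k)%N -> 0 < f`_i].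

(* The set H_k, used for 1 <= k. *)
Definition hurwitz k : set {poly R} :=
  [set f | pos_polys k f /\
    forall z : complex R, root (map_poly (real_complex R) f) z ->
      complex.Re z < 0].

(* Only meaningful for 2 <= i (truncated subtraction otherwise). *)
Definition lambda f (i : nat) : R :=
  (f`_(i - 2) * f`_(i + 1)) / (f`_i * f`_(i - 1)).

(* The set W_k, used for 1 <= k; by convention W_k = H_k for k = 1, 2. *)
Definition wclass k : set {poly R} :=
  if (k <= 2)%N then hurwitz k
  else [set f | pos_polys k f /\
    forall i, (2 <= i <= k - 1)%N -> lambda f i < 1].

(* Coefficientwise product; m is the common degree of p and q. *)
Definition hadamard m p q : {poly R} := \poly_(i < m.+1) (p`_i * q`_i).

Definition has_hadamard_factorization m g : Prop :=
  exists g1 g2, [/\ hurwitz m g1, hurwitz m g2 & g = hadamard m g1 g2].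

(* Generalized Hadamard product of f and g, of degrees n and m <= n: the set
   of the Hadamard products of g with the windows a_j, ..., a_(j+m) of the
   coefficients of f *)
Definition gen_hadamard n m f g : set {poly R} :=
  [set F | exists2 j, (j <= n - m)%N &
    F = \poly_(i < m.+1) (f`_(j + i) * g`_i)].

End Defs.

(* Main.v *)
(** Every positive sequence becomes Hurwitz after multiplication by a steep
    enough Gaussian: if q is small, then at the point [- q^(-2k)] the polynomial
    [\sum_i a_i q^(i^2) s^i] is, up to the factor [q^(-k^2)], equal to
    [\sum_i (-1)^i a_i q^((i-k)^2)], whose sign is that of its k-th term.
    These m + 1 alternating signs produce m distinct negative roots.  Hence
    [g = \sum_i q^(i^2) s^i] works as soon as q is small with respect to the
    coefficients of f, and its factors are the Gaussian polynomials with
    parameter [r = sqrt q]. *)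

Require Import Defs.
From mathcomp Require Import all_boot all_order all_algebra.
From mathcomp Require Import classical_sets reals.
From mathcomp Require Import complex polyrcf ring lra zify.

Local Open Scope classical_set_scope.
Local Open Scope ring_scope.

Import Order.TTheory GRing.Theory Num.Theory IntDist.

(** The intermediate value theorem yields a root strictly between any two consecutive points. These
    [m] roots are distinct and negative, and [p] has degree [m], so there is no room for further
    zeros. *)
Lemma hurwitz_alternating (R : realType) (m : nat) (p : {poly R})
    (x : nat -> R) :
  pos_polys m p -> x 0%N <= 0 -> (forall k, x k.+1 < x k) ->
  (forall k, (k < m)%N -> p.[x k.+1] * p.[x k] < 0) ->
  hurwitz m p.
Proof.
move=> pP x0 x_dec px_lt0; split=> // z pz.
have x_le i j : (i <= j)%N -> x j <= x i.
  move=> /subnKC<-; elim: (j - i)%N => [|d IH]; rewrite ?addn0 // addnS.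
  exact: le_trans (ltW (x_dec _)) IH.
have /fin_all_exists[y yP] (k : 'I_m) :
    exists y, [/\ x k.+1 < y, y < x k & root p y].
  have [y] := poly_ivtoo (ltW (x_dec k)) (px_lt0 k (ltn_ord k)).
  by rewrite in_itv /= => /andP[? ?] ?; exists y.
have y_dec (i j : 'I_m) : (i < j)%N -> y j < y i.
  move=> ij; have [_ yj _] := yP j; have [yi _ _] := yP i.
  exact: lt_le_trans yj (le_trans (x_le _ _ ij) (ltW yi)).
have y_inj : injective y.
  move=> i j yij; apply/val_inj/eqP; case: ltngtP => // /y_dec;
    by rewrite yij ltxx.
pose rs := [seq y k | k <- enum 'I_m].
have size_p : size p = (size rs).+1.
  by rewrite size_map size_enum_ord; case: pP.
have rs_root : all (root p) rs.
  by apply/allP => _ /mapP[k _ ->]; have [] := yP k.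
have rs_uniq : poly.uniq_roots rs.
  by rewrite uniq_rootsE map_inj_uniq ?enum_uniq.
have p_neq0 : p != 0 by rewrite -size_poly_gt0 size_p.
(* [p] splits over [R] into linear factors, so a complex zero of its image is the image of some
   [y k]. *)
move: pz; rewrite (all_roots_prod_XsubC size_p rs_root rs_uniq).
rewrite map_polyZ rootZ; last by rewrite fmorph_eq0 lead_coef_eq0.
rewrite rmorph_prod /= big_map.
rewrite rootE horner_prod prodf_seq_eq0 => /hasP[k _ /=].
rewrite rmorphB /= map_polyX map_polyC /= hornerXsubC subr_eq0 => /eqP -> /=.
have [_ yk _] := yP k; apply: lt_le_trans yk _.
exact: le_trans (x_le 0%N k (leq0n k)) x0.
Qed.

Lemma gauss_dominant_sign (R : realType) (m : nat) (a : nat -> R)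
    (lo hi q : R) (k : nat) :
  0 < q <= 1 -> (forall i, (i <= m)%N -> lo <= a i <= hi) ->
  0 < lo -> m%:R * hi * q < lo -> (k <= m)%N ->
  0 < (-1) ^+ k * (\poly_(i < m.+1) (a i * q ^+ (i ^ 2))).[- (q ^- 2) ^+ k].
Proof.
move=> /andP[q_gt0 q_le1] a_bd lo_gt0 small le_km.
have q_neq0 : q != 0 by rewrite gt_eqF.
(* The factor [q ^+ (k ^ 2)] completes the square: the exponent [i^2 - 2ik + k^2] becomes
   [|i - k|^2]. *)
rewrite horner_poly -(pmulr_rgt0 _ (exprn_gt0 (k ^ 2) q_gt0)).
rewrite mulr_sumr mulr_sumr.
under eq_bigr => i _.
  have -> : q ^+ (k ^ 2) * ((-1) ^+ k * (a i * q ^+ (i ^ 2) *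
      (- (q ^- 2) ^+ k) ^+ i)) =
      (-1) ^+ (k + i) * (a i * q ^+ (`|i - k| ^ 2)%N).
    have := sqrn_dist i k => /(congr1 (GRing.exp q)).
    rewrite [LHS]exprD [RHS]exprD => qE.
    have -> : (q ^- 2) ^+ k = (q ^+ (2 * k))^-1 by rewrite exprVn exprM.
    rewrite [(- _^-1) ^+ _]exprNn exprVn -exprM [in RHS]exprD -mulnA (mulnC k).
    apply: (mulIf (expf_neq0 (2 * (i * k)) q_neq0)).
    rewrite -[RHS]mulrA -[in RHS](mulrA (a i)) qE; field.
    by rewrite expf_neq0.
  over.
have kO : (k < m.+1)%N by [].
rewrite (bigD1 (Ordinal kO)) //= distnn expr0 mulr1.
rewrite -signr_odd addnn odd_double expr0 mul1r.
have hi_gt0 : 0 < hi.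
  have /andP[l h] := a_bd k le_km.
  exact: lt_le_trans (lt_le_trans lo_gt0 l) h.
set S := \sum_(_ < _ | _) _.
(* The isolated [k]-th term is [a k >= lo]. Each of the [m] other terms has an exponent at least 1,
   hence modulus at most [hi * q]. *)
suff : `|S| <= m%:R * hi * q.
  have /andP[l _] := a_bd k le_km.
  have := ler_norm (- S); rewrite normrN; lra.
apply: le_trans (ler_norm_sum _ _ _) _.
apply: (@le_trans _ _ (\sum_(i < m.+1 | i != Ordinal kO) (hi * q))); last first.
  by rewrite sumr_const cardC1 card_ord /= mulr_natl mulrnAl.
apply: ler_sum => i i_neq; have /andP[l h] := a_bd i (ltn_ord i).
rewrite normrM normrX normrN1 expr1n mul1r.
have a_ge0 : 0 <= a i by rewrite (le_trans (ltW lo_gt0)).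
have q_ge0 := ltW q_gt0.
rewrite ger0_norm ?mulr_ge0 ?exprn_ge0 // ler_pM ?exprn_ge0 //.
rewrite -[leRHS]expr1 ler_wiXn2l //.
by rewrite expn_gt0 lt0n distn_eq0 orbF.
Qed.

Lemma hurwitz_gauss (R : realType) (m : nat) (a : nat -> R) (lo hi q : R) :
  0 < q < 1 -> (forall i, (i <= m)%N -> lo <= a i <= hi) ->
  0 < lo -> m%:R * hi * q < lo ->
  hurwitz m (\poly_(i < m.+1) (a i * q ^+ (i ^ 2))).
Proof.
move=> /andP[q_gt0 q_lt1] a_bd lo_gt0 small.
have c_gt0 i : (i <= m)%N -> 0 < a i * q ^+ (i ^ 2).
  move=> /a_bd/andP[l _].
  by rewrite mulr_gt0 ?exprn_gt0 ?(lt_le_trans lo_gt0 l).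
apply: (@hurwitz_alternating _ _ _ (fun k => - (q ^- 2) ^+ k)).
- split=> [|i le_im]; last by rewrite coef_poly ltnS le_im c_gt0.
  by rewrite size_poly_eq //= gt_eqF // c_gt0.
- by rewrite expr0 oppr_le0.
- move=> k; rewrite ltrN2 ltr_eXn2l // invf_gt1 ?exprn_gt0 //.
  by rewrite exprn_ilt1 // ltW.
- move=> k lt_km; have q01 : 0 < q <= 1 by rewrite q_gt0 ltW.
  have := gauss_dominant_sign _ _ _ _ _ _ k q01 a_bd lo_gt0 small (ltnW lt_km).
  have := gauss_dominant_sign _ _ _ _ _ _ k.+1 q01 a_bd lo_gt0 small lt_km.
  (* The two sign factors multiply to -1, so the values at consecutive points have opposite
     signs. *)
  move=> s1 s0; have := mulr_gt0 s1 s0.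
  rewrite mulrACA exprS -(mulrA (-1)) -expr2 sqrr_sign mulr1 mulN1r; lra.
Qed.

Lemma wclass_pos (R : realType) (n : nat) (f : {poly R}) :
  wclass n f -> pos_polys n f.
Proof. by rewrite /wclass; case: ifP => _ []. Qed.

(** Both extrema are seeded with 1, so that the bounds also hold for the constant sequence 1, which
    gives the Gaussian polynomials themselves. *)
Lemma pos_polys_bounds (R : realType) (n : nat) (f : {poly R}) :
  pos_polys n f -> exists lo hi : R, [/\ 0 < lo, lo <= 1, 1 <= hi
    & forall i, (i <= n)%N -> lo <= f`_i <= hi].
Proof.
move=> [_ f_gt0].
exists (\big[Order.min/1]_(i < n.+1) f`_i), (\big[Order.max/1]_(i < n.+1) f`_i).
split.
- by apply: lt_bigmin => // i _; rewrite f_gt0 // -ltnS.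
- exact: bigmin_le_id.
- exact: bigmax_ge_id.
- move=> i; rewrite -ltnS => lt_in.
  by rewrite (bigmin_le _ (Ordinal lt_in)) (le_bigmax _ _ (Ordinal lt_in)).
Qed.

Theorem theorem8 (R : realType) (n : nat) (n_gt0 : (0 < n)%N) (f : {poly R})
    (fW : wclass n f) :
  forall m : nat, (1 <= m <= n)%N ->
    exists g : {poly R},
      [/\ hurwitz m g,
          has_hadamard_factorization m g
        & gen_hadamard n m f g `<=` hurwitz m].
Proof.
move=> m /andP[m_gt0 le_mn].
have [lo [hi [lo_gt0 lo_le1 hi_ge1 f_bd]]] :=
  pos_polys_bounds _ _ _ (wclass_pos _ _ _ fW).
have m_ge1 : 1 <= m%:R :> R by rewrite ler1n.
(* The summand 1 makes [m%:R * hi * r < lo] strict. With [lo <= 1 <= m%:R * hi] this forces [r < 1],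
   so [r ^+ 2] is small enough too. *)
pose r := lo / (m%:R * hi + 1).
have mhi_ge1 : 1 <= m%:R * hi by rewrite mulr_ege1.
have den_gt0 : 0 < m%:R * hi + 1 by lra.
have r_gt0 : 0 < r by rewrite divr_gt0.
have r_small : m%:R * hi * r < lo.
  by have -> : lo = (m%:R * hi + 1) * r; [rewrite mulrC divfK ?gt_eqF|lra].
have r_lt1 : r < 1 by nra.
have r2_small : m%:R * hi * r ^+ 2 < lo by nra.
have r2_01 : 0 < r ^+ 2 < 1 by rewrite exprn_gt0 ?exprn_ilt1 // ltW.
have one_bd i : (i <= m)%N -> lo <= 1 <= hi by rewrite lo_le1.
(* The factor 1 presents [G q] as the case [a i = 1] of [hurwitz_gauss]. *)
pose G (q : R) := \poly_(i < m.+1) (1 * q ^+ (i ^ 2)).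
have hG_r : hurwitz m (G r).
  by apply: (@hurwitz_gauss _ _ _ lo hi) => //; rewrite r_gt0.
exists (G (r ^+ 2)); split.
- exact: (@hurwitz_gauss _ _ _ lo hi).
- exists (G r), (G r); split=> //.
  apply/polyP => i; rewrite !coef_poly; case: ifP => // _.
  by rewrite !mul1r -exprM mulnC exprM expr2.
- move=> _ [j le_j ->].
  have -> : \poly_(i < m.+1) (f`_(j + i) * (G (r ^+ 2))`_i) =
      \poly_(i < m.+1) (f`_(j + i) * (r ^+ 2) ^+ (i ^ 2)).
    by apply/polyP => i; rewrite !coef_poly; case: ifP => // ->; rewrite mul1r.
  (* Since [j <= n - m], every window stays within the indices up to [n]; the same bounds, hence the
     same [r], serve all [j]. *)
  apply: (@hurwitz_gauss _ _ _ lo hi) => // i le_im.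
  by apply: f_bd; lia.
Qed.
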